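(* Let $G$ be a connected planar graph. Then there are a graph $G_1$ with $CCW(G_1)\le 7$ and a chordal graph $G_2$ such that $G=G_1\cap G_2$.
   Context: Graphs are finite, simple and undirected. $G=G_1\cap G_2$ means that $V(G_1)=V(G_2)=V(G)$ and $E(G)=E(G_1)\cap E(G_2)$. A clique cover of a graph $G$ is a partition of $V(G)$ into cliques. For an ordered clique cover $C=\{C_0,C_1,\dots,C_t\}$, its width is $W(C)=\max\{|j-i| : xy\in E(G),\ x\in C_i,\ y\in C_j\}$ (taken as $0$ if there are no edges). The clique cover width $CCW(G)$ is the smallest width over all ordered clique covers of $G$. A graph is chordal if it has no induced (chordless) cycle of length at least four. *)

(* Defs.v *)
From mathcomp Require Import all_boot all_order all_algebra.
From mathcomp Require Import all_classical all_reals all_analysis.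
Import numFieldNormedType.Exports.

Set Implicit Arguments.
Unset Strict Implicit.
Unset Printing Implicit Defensive.

Record sgraph (T : finType) := SGraph {
  adj :> rel T;
  adj_sym : symmetric adj;
  adj_irr : irreflexive adj }.

Definition connected_graph (T : finType) (G : sgraph T) : Prop :=
  forall x y : T, connect G x y.

Definition clique (T : finType) (G : sgraph T) (A : {set T}) : bool :=
  [forall x in A, forall y in A, (x != y) ==> G x y].

(* The blocks of a partition are nonempty. *)
Definition ordered_clique_cover (T : finType) (G : sgraph T)
    (C : seq {set T}) : bool :=
  [&& uniq C, finset.partition [set X in C]%SET [set: T]%SET & all (clique G) C].

(* C is not empty unless T is, and \max over an empty range is 0, the width of
   an edgeless graph. *)
Definition width (T : finType) (G : sgraph T) (C : seq {set T}) : nat :=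
  \max_(i < size C) \max_(j < size C |
      [exists x in nth finset.set0 C i, exists y in nth finset.set0 C j, G x y])
    `|j - i|%N.

Lemma ex_clique_cover_width (T : finType) (G : sgraph T) :
  exists w : nat,
    `[< exists2 C, ordered_clique_cover G C & width G C = w >].
Proof.
pose C : seq {set T} := [seq [set x]%SET | x <- enum T].
exists (width G C); apply/asboolP; exists C => //.
have inC (X : {set T}) : reflect (exists x, X = [set x]%SET) (X \in C).
  apply: (iffP mapP) => [[x _ ->]|[x ->]]; first by exists x.
  by exists x; rewrite ?mem_enum.
apply/and3P; split.
- by rewrite map_inj_uniq ?enum_uniq //; exact: set1_inj.
- apply/and3P; split.
  + rewrite finset.eqEsubset finset.subsetT; apply/fintype.subsetP => x _.
    by apply/bigcupP; exists [set x]%SET; rewrite ?finset.inE //; apply/inC; exists x.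
  + apply/finset.trivIsetP => X Y; rewrite !finset.inE => /inC[x ->] /inC[y ->] xy.
    rewrite disjoints1 finset.inE; apply: contra xy => /eqP ->; exact: eqxx.
  + rewrite finset.inE; apply/negP => /inC[x] /setP/(_ x).
    by rewrite !finset.inE eqxx.
- apply/allP => X /inC[x ->]; apply/forall_inP => y /set1P ->.
  by apply/forall_inP => z /set1P ->; rewrite eqxx.
Qed.

Definition CCW (T : finType) (G : sgraph T) : nat :=
  ex_minn (ex_clique_cover_width G).

(* The only adjacencies between vertices of the cycle p are those between
   cyclically consecutive ones. *)
Definition induced_cycle (T : finType) (G : sgraph T) (p : seq T) : Prop :=
  [/\ uniq p, cycle G p &
      {in p &, forall x y, G x y -> y = next p x \/ x = next p y}].

Definition chordal (T : finType) (G : sgraph T) : Prop :=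
  forall p : seq T, 4 <= size p -> ~ induced_cycle G p.

Local Open Scope classical_set_scope.
Local Open Scope ring_scope.

Definition jordan_arc (R : realType) (a b : R * R) (A : set (R * R)) : Prop :=
  exists f : R -> R * R,
    [/\ {within `[0, 1], continuous f}, {in `[0, 1] &, injective f},
        f 0 = a, f 1 = b & A = f @` `[0, 1]].

(* A drawing without crossings: the vertex x is placed at pos x and the edge
   xy is drawn as edge [set x; y]. *)
Definition plane_drawing (R : realType) (T : finType) (G : sgraph T)
    (pos : T -> R * R) (edge : {set T} -> set (R * R)) : Prop :=
  [/\ injective pos,
      forall x y, G x y -> jordan_arc (pos x) (pos y) (edge [set x; y]%SET),
      forall x y z, G x y -> edge [set x; y]%SET (pos z) ->
        z \in [set x; y]%SET &
      forall x y u v, G x y -> G u v -> [set x; y]%SET <> [set u; v]%SET ->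
        forall a, edge [set x; y]%SET a -> edge [set u; v]%SET a ->
        exists2 z, z \in ([set x; y] :&: [set u; v])%SET & a = pos z].

Definition planar (R : realType) (T : finType) (G : sgraph T) : Prop :=
  exists pos edge, @plane_drawing R T G pos edge.

(* Main.v *)
Require Import Defs.
From mathcomp Require Import all_boot.
From mathcomp Require Import zify.
From mathcomp Require boolp.

Set Implicit Arguments.
Unset Strict Implicit.
Unset Printing Implicit Defensive.

(** Rounding the drawing to a fine square grid turns [G] into a minor of the
    grid: disjoint connected sets of cells, one per vertex, adjacent along the
    edges.  Cells left over become vertices of their own.  Breadth first search
    from the outside gives every vertex a level, and lifts to a spanning tree of
    the cells (rooted at infinity).  The corners of the cells, joined across the
    sides not used by this tree, form a tree by Euler's formula, and the union of
    the root paths of the four cells at a corner is a bag: this is a tree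
    decomposition, because one can walk around the subtree below a cell without
    crossing the tree.  A bag has at most four vertices on each level, so the
    chordal graph [G2] of the pairs sharing a bag can be coloured with four
    colours on each level.  In [G1] each (level, colour) class is made a clique;
    an edge of [G] joins consecutive levels, hence has length at most 4 + 3. *)

(** * Breadth first search and spanning trees *)

Section Distance.
Variables (X : finType) (e : rel X) (root : pred X).

Fixpoint reaches_root_in n x :=
  root x || (if n is n'.+1 then [exists y, e x y && reaches_root_in n' y] else false).

Lemma reaches_root_in_step n x y : e x y -> reaches_root_in n y -> reaches_root_in n.+1 x.
Proof. by move=> exy wy /=; apply/orP; right; apply/existsP; exists y; rewrite exy. Qed.

(** With [d] the length of a shortest walk to a root, the first edge of such a walk gives the first
    clause, and prefixing an edge to one gives the second. *)
Lemma exists_distance :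
  (forall x, exists2 y, root y & connect e x y) ->
  exists d : X -> nat,
    (forall x, ~~ root x -> exists2 y, e x y & d x = (d y).+1) /\
    (forall x y, e x y -> d x <= (d y).+1).
Proof.
move=> reach.
have ex_reach x : exists n, reaches_root_in n x.
  have [y ry /connectP[p pth lst]] := reach x.
  exists (size p); elim: p x pth lst => [|z p IH] x /=; first by move=> _ <-; rewrite ry.
  move=> /andP[exz pth] lst; apply/orP; right; apply/existsP; exists z.
  by rewrite exz IH.
exists (fun x => ex_minn (ex_reach x)); split=> [x nrx|x y exy].
- case: ex_minnP => -[|n] /=; first by rewrite (negbTE nrx).
  rewrite (negbTE nrx) => /existsP[y /andP[exy wy]] minx; exists y => //.
  case: ex_minnP => m wm miny; congr _.+1; apply/eqP; rewrite eqn_leq (miny _ wy) andbT.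
  exact: (minx m.+1 (reaches_root_in_step exy wm)).
- case: ex_minnP => n _ minx; case: ex_minnP => m wm _; exact/minx/(reaches_root_in_step exy wm).
Qed.

End Distance.

(* Only the upper bound [#|A| < #|F|] on the number of edges is needed: it
   turns a breadth first spanning tree into the whole graph. *)
Lemma connected_card_tree (F E : finType) (s t : E -> F) (A : {set E}) :
  #|A| < #|F| ->
  (forall f g, connect
     [rel f g | [exists e in A, ((s e == f) && (t e == g)) || ((s e == g) && (t e == f))]] f g) ->
  exists (par : F -> F) (d : F -> nat),
    (forall f, par f = f \/ d (par f) < d f) /\
    (forall e, e \in A -> par (s e) = t e \/ par (t e) = s e).
Proof.
move=> cardA conn; set r := [rel f g | _] in conn.
have [f0 _] : exists f0 : F, true.
  by have /card_gt0P[f0 _] := leq_ltn_trans (leq0n _) cardA; exists f0.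
have [|d [dstep _]] := @exists_distance F r (pred1 f0).
  by move=> x; exists f0; rewrite //= eqxx.
(* The edge is optional only to give [f0] a value, as [E] may be empty. *)
have pick f : exists ge : F * option E, f != f0 ->
    d f = (d ge.1).+1 /\ exists2 e, ge.2 = Some e & e \in A /\
      (s e = f /\ t e = ge.1 \/ s e = ge.1 /\ t e = f).
  have [->|nf] := eqVneq f f0; first by exists (f0, None).
  have [g /existsP[e /andP[eA es]] dg] := dstep _ nf.
  exists (g, Some e); split=> //; exists e => //; split=> //.
  by case/orP: es => /andP[/eqP-> /eqP->]; [left|right].
have {pick} [ge geP] := boolp.choice pick.
pose par f := if f == f0 then f0 else (ge f).1.
have dpar f : f != f0 -> d f = (d (par f)).+1.
  by move=> nf; have [] := geP f nf; rewrite /par (negbTE nf).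
have parP f : f != f0 -> exists2 e, (ge f).2 = Some e & e \in A /\
      (s e = f /\ t e = par f \/ s e = par f /\ t e = f).
  by move=> nf; have [_] := geP f nf; rewrite /par (negbTE nf).
exists par, d; split=> [f|e eA].
  have [->|/dpar->] := eqVneq f f0; last by right.
  by left; rewrite /par eqxx.
(* Two different nodes picking the same edge would be each other's parent, against the depths. *)
have inj : {in predC1 f0 &, injective (fun f => (ge f).2)}.
  move=> f g /= nf ng; have := dpar f nf; have := dpar g ng.
  have [e1 -> [_ H1]] := parP f nf; have [e2 -> [_ H2]] := parP g ng.
  move=> dg df [e12]; subst e2.
  case: H1 H2 => -[sf tf] [] [sg tg]; rewrite -?sf -?sg -?tf -?tg //.
  - by exfalso; move: df dg; rewrite -tf -sg tg sf; lia.
  - by exfalso; move: df dg; rewrite -sf -tg sg tf; lia.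
pose B := [set (ge f).2 | f in predC1 f0].
have BA : B \subset Some @: A.
  apply/subsetP => o /imsetP[f nf ->]; have [e1 -> [e1A _]] := parP f nf.
  exact: imset_f.
(* The nodes other than [f0] pick distinct edges of [A] and are at least [#|A|] in number, so every
   edge of [A] is picked. *)
have cB : #|Some @: A| <= #|B|.
  rewrite card_imset; last by move=> ? ? [].
  rewrite card_in_imset //.
  by rewrite cardC1; move: cardA; lia.
have /eqP BE : B == Some @: A by rewrite eqEcard BA cB.
have : Some e \in B by rewrite BE imset_f.
case/imsetP => f nf; have [e1 -> [_ H]] := parP f nf => -[->].
by case: H => -[-> ->]; [left|right].
Qed.

(** * Chordality and colouring of the graph of a tree decomposition *)

Section TreeDecomposition.

(* [S v f] says that the vertex [v] is in the bag of the node [f]. *)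
Variables (F V : finType) (par : F -> F) (d : F -> nat) (S : V -> pred F).
Hypothesis dpar : forall f, par f = f \/ d (par f) < d f.
Hypothesis S_neq0 : forall v, exists f, S v f.
Hypothesis S_conn : forall v f g, S v f -> S v g ->
  connect [rel f g | [&& S v f, S v g & (par f == g) || (par g == f)]] f g.

Lemma exists_top v :
  exists t, S v t /\ forall f, S v f -> f = t \/ S v (par f) /\ d (par f) < d f.
Proof.
have [f0 Sf0] := S_neq0 v.
case: (@arg_minnP _ f0 (S v) d Sf0) => t St mint.
exists t; split=> // f Sf.
have [->|nft] := eqVneq f t; first by left.
right; have anc g : fconnect par g f -> d f <= d g /\ (d f = d g -> g = f).
  move=> /connectP[p]; elim: p g => [|h p IH] g /=; first by move=> _ ->.
  move=> /andP[/eqP<- pth] lst; have [le1 eq1] := IH _ pth lst.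
  by case: (dpar g) => [pg|pg]; [move: le1 eq1; rewrite pg | split; lia].
case: (boolP (S v (par f) && (d (par f) < d f))) => [/andP[]//|stuck].
exfalso; have /connectP[p pth lst] := S_conn Sf St.
(* A walk through nodes holding [v] leaves the descendants of [f] only by the step from [f] to
   [par f], which [stuck] excludes. So [t] is a descendant of [f], and minimality of [d t] forces
   [f = t]. *)
have : fconnect par t f.
  have : fconnect par f f by exact: connect0.
  rewrite lst; move: {lst}pth.
  have : forall q g, path [rel f g | [&& S v f, S v g & (par f == g) || (par g == f)]] g q ->
    fconnect par g f -> fconnect par (last g q) f; last exact.
  elim=> [|h q IH] g //= /andP[/and3P[_ Sh gh] pth] gf.
  apply: IH => //; case/orP: gh => [/eqP gh|/eqP gh]; last first.
    by apply: connect_trans gf; apply: connect1; rewrite /= gh.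
  move: gf => /connectP[[|k q']] /= => [_ fg|/andP[/eqP gk pq] lq].
    case: (dpar f) => [ff|lt]; first by rewrite -gh -fg ff connect0.
    by move: stuck; rewrite lt andbT fg gh Sh.
  by rewrite -gh gk; apply/connectP; exists q'.
by move=> /anc[le eq]; move: nft; rewrite (eq _) ?eqxx //; have := mint _ Sf; lia.
Qed.

Definition share_bag : rel V := [rel x y | (x != y) && [exists f, S x f && S y f]].

Lemma share_bag_sym : symmetric share_bag.
Proof.
move=> x y; rewrite /share_bag /= eq_sym; congr (_ && _).
by apply: eq_existsb => f; rewrite andbC.
Qed.

(** Climbing from a common node, the deeper of the two tops is reached while the other vertex is
    still present. Thus all neighbours of [y] whose tops are no deeper lie in the bag of [top y]:
    this is a perfect elimination order. *)
Lemma exists_simplicial_order : exists (top : V -> F),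
  (forall v, S v (top v)) /\
  (forall x y, share_bag x y -> d (top x) <= d (top y) -> S x (top y)).
Proof.
have [top topP] := boolp.choice exists_top; exists top; split=> [v|x y].
  by case: (topP v).
case/andP=> _ /existsP[f /andP[]]; have [n] := ubnP (d f).
elim: n f => // n IH f ltn Sx Sy le_xy.
have [_ /(_ f Sy)[<-//|[Sy' lt]]] := topP y.
have [_ /(_ f Sx)[fE|[Sx' _]]] := topP x; last by apply: IH Sx' Sy' le_xy; lia.
(* Here [x] stops at [f] while [y] goes on to [par f], so [top y] would be strictly shallower than
   [top x], against [le_xy]. *)
suff H : forall g, S y g -> d (top y) <= d g by have := H _ Sy'; rewrite fE in lt *; lia.
move=> g; have [m] := ubnP (d g); elim: m g => // m IHm g ltm Sg.
have [_ /(_ g Sg)[->//|[Sg' ltg]]] := topP y.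
by apply: leq_trans (IHm _ _ Sg') (ltnW ltg); lia.
Qed.

(** Both cycle neighbours of the vertex [v] with deepest top lie in the bag of [top v], hence are
    adjacent; on a cycle of length at least four this is a chord. *)
Lemma share_bag_chordal (p : seq V) : uniq p -> cycle share_bag p ->
  {in p &, forall x y, share_bag x y -> y = next p x \/ x = next p y} ->
  size p < 4.
Proof.
have [top [_ topS]] := exists_simplicial_order; move=> Up cp chord.
rewrite leqNgt; apply/negP => size_p.
have [x0 x0p] : exists x0, x0 \in p by case: p size_p {Up cp chord} => // x; exists x; rewrite inE eqxx.
case: (@arg_maxnP _ x0 (mem p) (fun v => d (top v)) x0p) => v vp maxv.
have [i q rot_p] := rot_to vp.
have nextE := next_rot i Up; have memE := mem_rot i p.
have {cp} cp : cycle share_bag (rot i p) by rewrite rot_cycle.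
have {}size_p : 4 <= size (rot i p) by rewrite size_rot.
have {}Up : uniq (rot i p) by rewrite rot_uniq.
rewrite rot_p in nextE memE cp size_p Up.
have sub u : u \in v :: q -> share_bag u v -> S u (top v).
  by rewrite memE => up uv; apply: topS uv _; exact: maxv.
case: q size_p Up cp nextE memE sub {rot_p} => [//|a [//|b q]] size_p Up cp nextE memE sub.
pose u := last b q; have uq : u \in b :: q by exact: mem_last.
have au : a != u by apply: contraTneq Up => ->; rewrite /= uq andbF.
have share_au : share_bag a u.
  move: cp; rewrite /= rcons_path -/u => /and3P[va _ /andP[_ uv]].
  apply/andP; split=> //; apply/existsP; exists (top v); rewrite !sub //.
  - by rewrite !inE -in_cons uq !orbT.
  - by rewrite !inE eqxx orbT.
  - by rewrite share_bag_sym.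
have ap : a \in p by rewrite -memE !inE eqxx orbT.
have up : u \in p by rewrite -memE !inE -in_cons uq !orbT.
have [nau nva] : next p a = b /\ next p u = v.
  rewrite -!nextE; split.
    by rewrite /= eqxx; case: eqP Up => // ->; rewrite /= inE eqxx.
  (* As [u] is the last entry, its index is out of range in the tail and the default, the head [v],
     is returned. *)
  have := next_nth (v :: a :: b :: q) u; rewrite !inE -in_cons uq !orbT => ->.
  rewrite nth_default //; apply: leq_trans (_ : index (last v [:: a, b & q]) [:: v, a, b & q] >= _) _.
    by rewrite index_last.
  by [].
(* The first case makes [b] the last entry, so the cycle has length three; the second identifies [a]
   with [v]. *)
have [uE|aE] := chord _ _ ap up share_au.
- have {}uE : last b q = b by rewrite -[RHS]nau -uE.
  clear -size_p Up uE; case: q size_p Up uE => //= c q _ /and4P[_ _ + _] uE.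
  by rewrite -{1}uE mem_last.
- by move: Up; rewrite aE nva /= inE eqxx.
Qed.

(** Greedy colouring by increasing depth of [top]: the neighbours of [v] already coloured on its
    level lie with [v] in the bag of [top v], so at most [k] colours are blocked. *)
Lemma share_bag_colouring k (lev : V -> nat) :
  (forall f l, #|[set v | S v f & lev v == l]| <= k.+1) ->
  exists col : V -> 'I_k.+1,
    forall x y, share_bag x y -> lev x = lev y -> col x != col y.
Proof.
move=> small; have [top [Stop topS]] := exists_simplicial_order.
suff /(_ #|V| setT) : forall n (A : {set V}), #|A| <= n -> exists col : V -> 'I_k.+1,
    {in A &, forall x y, share_bag x y -> lev x = lev y -> col x != col y}.
  by rewrite cardsT => /(_ (leqnn _))[col H]; exists col => x y; apply: H; rewrite inE.
elim=> [|n IH] A.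
  by rewrite leqn0 cards_eq0 => /eqP->; exists (fun=> ord0) => x y; rewrite inE.
have [->|[x0 x0A]] := set_0Vmem A.
  by exists (fun=> ord0) => x y; rewrite inE.
case: (@arg_maxnP _ x0 (mem A) (fun v => d (top v)) x0A) => v vA maxv cA.
have [|col colP] := IH (A :\ v); first by move: cA; rewrite (cardsD1 v A) [v \in A]vA.
pose B := [set u in A :\ v | share_bag u v && (lev u == lev v)].
have cB : #|[set col u | u in B]| < k.+1.
  apply: leq_ltn_trans (leq_imset_card _ _) _.
  apply: leq_trans (small (top v) (lev v)).
  rewrite (cardsD1 v [set _ | _ & _]) inE Stop eqxx ltnS.
  apply/subset_leq_card/subsetP => u; rewrite !inE.
  case/andP=> /andP[-> uA] /andP[uv ->]; rewrite /= topS //.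
  exact: maxv.
have /set0Pn[c] : ~: [set col u | u in B] != set0.
  by rewrite -card_gt0 cardsCs setCK card_ord subn_gt0.
rewrite inE => /negP cP; exists (fun u => if u == v then c else col u) => x y xA yA.
have [->|nx] := eqVneq x v; have [->|ny] := eqVneq y v => sxy lxy.
- by move: sxy; rewrite /share_bag /= eqxx.
- apply/negP => /eqP cE; apply: cP; rewrite cE; apply: imset_f.
  by rewrite !inE ny yA share_bag_sym sxy lxy eqxx.
- apply/negP => /eqP cE; apply: cP; rewrite -cE; apply: imset_f.
  by rewrite !inE nx xA sxy lxy eqxx.
- by apply: colP; rewrite ?inE ?nx ?ny.
Qed.

End TreeDecomposition.

(** * The square grid: cells, corners and sides *)

Section Grid.
Variable n : nat.

(* The cell [(i, j)] is a vertex of the primal grid; everything outside the box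
   is one more vertex, at infinity.  Faces are the corners of the cells, and an
   edge is represented by the pair of horizontally ([true]) or vertically
   ([false]) consecutive corners that it separates. *)
Definition cell := ('I_n * 'I_n)%type.
Definition face := ('I_n.+1 * 'I_n.+1)%type.
Definition gedge := (bool * 'I_n * 'I_n.+1)%type.
(** The first boolean selects the axis, [true] being the second coordinate; the second is [true] in
    the increasing direction. *)
Definition dir := (bool * bool)%type.

Definition bshift (b : bool) (i : 'I_n) : 'I_n.+1 :=
  if b then lift ord0 i else widen_ord (leqnSn n) i.

Lemma val_bshift b i : bshift b i = i + b :> nat.
Proof. by case: b; rewrite /= ?addn0 // /bump leq0n addnC. Qed.

Lemma bshift_inj b : injective (bshift b).
Proof. by move=> i j /(congr1 val); rewrite /= !val_bshift => /addIn/val_inj. Qed.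

Definition corner (p : cell) (c : bool * bool) : face :=
  (bshift c.1 p.1, bshift c.2 p.2).

Definition edge_end (b : bool) (e : gedge) : face :=
  if e.1.1 then (bshift b e.1.2, e.2) else (e.2, bshift b e.1.2).

Definition side (p : cell) (x : dir) : gedge :=
  if x.1 then (true, p.1, bshift x.2 p.2) else (false, p.2, bshift x.2 p.1).

Lemma edge_end_side b p x :
  edge_end b (side p x) = corner p (if x.1 then (b, x.2) else (x.2, b)).
Proof. by case: x => -[] c. Qed.

Definition step (b : bool) (i : 'I_n) : option 'I_n :=
  if b then insub i.+1 else if val i is j.+1 then insub j else None.

Lemma stepP b i j : (step b i = Some j) <-> (bshift (~~ b) j = bshift b i).
Proof.
split=> [|/(congr1 val)].
  move=> bij; apply/val_inj; rewrite /= !val_bshift; move: bij; rewrite /step.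
  case: b => /=; first by case: insubP => // k _ kE [<-]; rewrite kE; lia.
  by case: i => -[|i] //= lti; case: insubP => // k _ kE [<-]; rewrite kE; lia.
rewrite /= !val_bshift /step; case: b => /= ij.
  by case: insubP => [k _ kE|]; [congr Some; apply/val_inj; rewrite /= kE; lia | have := ltn_ord j; lia].
case: i ij => -[|i] lti /= ij; first by lia.
by case: insubP => [k _ kE|]; [congr Some; apply/val_inj; rewrite /= kE; lia | have := ltn_ord j; lia].
Qed.

Definition nbr (p : cell) (x : dir) : option cell :=
  if x.1 then omap (pair p.1) (step x.2 p.2) else omap (pair^~ p.2) (step x.2 p.1).

Definition opp (x : dir) : dir := (x.1, ~~ x.2).

(** Adjacency of cells becomes equality of sides, the form in which sides can be counted and
    followed. *)
Lemma nbrP p x q : nbr p x = Some q <-> side q (opp x) = side p x.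
Proof.
case: p q => p1 p2 [q1 q2]; case: x => -[] b; rewrite /nbr /side /=; split.
- by case s: (step b p2) => [j|] //= [<- <-]; congr (_, _); apply/stepP.
- by case=> -> /stepP ->.
- by case s: (step b p1) => [j|] //= [<- <-]; congr (_, _); apply/stepP.
- by case=> -> /stepP ->.
Qed.

Lemma nbr_opp p x q : nbr p x = Some q -> nbr q (opp x) = Some p.
Proof. by move=> /nbrP H; apply/nbrP; rewrite H /opp /= negbK -surjective_pairing. Qed.

Lemma eq_side p x q y : side p x = side q y ->
  p = q /\ x = y \/ nbr p x = Some q /\ y = opp x.
Proof.
case: p q => p1 p2 [q1 q2]; case: x y => [[] b] [[] c] //; rewrite /side /= => -[<- e].
- have [bc|bc] := eqVneq b c; first by left; subst c; rewrite (bshift_inj e).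
  right; have cE : c = ~~ b by case: b c bc {e} => -[].
  by subst c; split=> //; apply/nbrP; rewrite /side /= e.
- have [bc|bc] := eqVneq b c; first by left; subst c; rewrite (bshift_inj e).
  right; have cE : c = ~~ b by case: b c bc {e} => -[].
  by subst c; split=> //; apply/nbrP; rewrite /side /= e.
Qed.

Lemma gedge_is_side (e : gedge) : exists p, exists x, side p x = e.
Proof.
case: e => -[o k] l.
have [b [j ->]] : exists b j, l = bshift b j.
  (* Lower ends give every corner coordinate but the last, which is the upper end of the last
     cell. *)
  have [lt|ge] := ltnP l n.
    by exists false, (Ordinal lt); apply/val_inj; rewrite [RHS]val_bshift addn0.
  have n0 : n.-1 < n by have := ltn_ord k; lia.
  exists true, (Ordinal n0); apply/val_inj; rewrite [RHS]val_bshift /=.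
  by have := ltn_ord l; lia.
by case: o; [exists (k, j), (true, b) | exists (j, k), (false, b)].
Qed.

(** From the origin, move along the first axis and then along the second, one grid edge at a
    time. *)
Lemma connect_face (r : rel face) : symmetric r ->
  (forall e, connect r (edge_end false e) (edge_end true e)) ->
  forall f g, connect r f g.
Proof.
move=> symr re.
suff H f : connect r (ord0, ord0) f.
  by move=> f g; apply: connect_trans (H g); rewrite (sym_connect_sym symr).
have up1 j : forall m (lt : m < n.+1), connect r (ord0, j) (Ordinal lt, j).
  elim=> [|m IH] lt; first by rewrite (_ : Ordinal lt = ord0); [exact: connect0 | exact/val_inj].
  have lt' : m < n by [].
  apply: connect_trans (IH (ltnW lt)) _; pose e : gedge := (true, Ordinal lt', j).
  have -> : (Ordinal (ltnW lt), j) = edge_end false e.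
    by apply/pair_equal_spec; split=> //; apply/val_inj; rewrite [RHS]val_bshift /= addn0.
  have -> : (Ordinal lt, j) = edge_end true e; last exact: re.
  by apply/pair_equal_spec; split=> //; apply/val_inj; rewrite [RHS]val_bshift /= addn1.
have up2 i : forall m (lt : m < n.+1), connect r (i, ord0) (i, Ordinal lt).
  elim=> [|m IH] lt; first by rewrite (_ : Ordinal lt = ord0); [exact: connect0 | exact/val_inj].
  have lt' : m < n by [].
  apply: connect_trans (IH (ltnW lt)) _; pose e : gedge := (false, Ordinal lt', i).
  have -> : (i, Ordinal (ltnW lt)) = edge_end false e.
    by apply/pair_equal_spec; split=> //; apply/val_inj; rewrite [RHS]val_bshift /= addn0.
  have -> : (i, Ordinal lt) = edge_end true e; last exact: re.
  by apply/pair_equal_spec; split=> //; apply/val_inj; rewrite [RHS]val_bshift /= addn1.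
case: f => -[i lti] [j ltj]; exact: connect_trans (up1 _ _ lti) (up2 _ _ ltj).
Qed.

(** * A spanning tree of the cells and its dual tree on the corners *)

Section Tree.

Variables (pd : cell -> dir) (r : cell -> nat).
Hypothesis r_up : forall p q, nbr p (pd p) = Some q -> r q < r p.

(** The parent in the tree; [None] means that it is the vertex at infinity. The rank [r] excludes
    cycles. *)
Definition up p := nbr p (pd p).
Definition desc : rel cell := connect [rel p q | up p == Some q].
(** Equivalently, [p] lies on the root path of a cell with corner [f]. For fixed [p] this is the
    region below [p]; for fixed [f] it is a bag. *)
Definition touch p f := [exists q, desc q p && [exists c, corner q c == f]].
Definition cotree : {set gedge} := ~: [set side p (pd p) | p : cell].
Definition cotree_adj : rel face := [rel f g | [exists e in cotree,
  ((edge_end false e == f) && (edge_end true e == g)) ||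
  ((edge_end false e == g) && (edge_end true e == f))]].

(** Two cells crossing one side would be each other's parent, so [n ^ 2] of the [2 * n * (n + 1)]
    sides are crossed. The remaining [n ^ 2 + 2 * n] are one fewer than the corners. *)
Lemma card_cotree : #|cotree| < #|{: face}|.
Proof.
have inj : injective (fun p => side p (pd p)).
  move=> p q pq; case: (eq_side pq) => [[]//|[pup qd]].
  have qup : nbr q (pd q) = Some p by rewrite qd; exact: nbr_opp.
  by have := r_up pup; have := r_up qup; lia.
have := cardsC [set side p (pd p) | p : cell]; rewrite -/cotree card_imset //.
rewrite !card_prod !card_ord card_bool; set k := #|cotree|; clearbody k; clear; nia.
Qed.

Lemma cotree_adj_sym : symmetric cotree_adj.
Proof. by move=> f g; apply: eq_existsb => e; rewrite orbC. Qed.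

Lemma touch_corner p q c : desc q p -> touch p (corner q c).
Proof.
move=> qp; apply/existsP; exists q; rewrite qp; apply/existsP; by exists c.
Qed.

Lemma touch_desc p q f : desc q p -> touch q f -> touch p f.
Proof.
move=> qp /existsP[q' /andP[q'q c]]; apply/existsP; exists q'.
by rewrite c andbT; exact: connect_trans q'q qp.
Qed.

Lemma connect_last (X : finType) (e : rel X) x y :
  connect e x y -> x = y \/ exists2 z, connect e x z & e z y.
Proof.
move=> /connectP[p]; case/lastP: p => [_ ->|p z]; first by left.
rewrite rcons_path last_rcons => /andP[pth lz] ->; right.
by exists (last x p) => //; apply/connectP; exists p.
Qed.

Definition tour p : rel face :=
  [rel f g | [&& touch p f, touch p g & cotree_adj f g]].

Lemma tour_sym p : symmetric (tour p).
Proof. by move=> f g; rewrite {1}/tour [LHS]/= [RHS]/= andbCA; do 2!congr (_ && _); exact: cotree_adj_sym. Qed.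

(* Turning around a cell [p], every side but the one towards the parent is
   either crossed or avoided by touring the subtree behind it. *)
Lemma touch_connected p f g : touch p f -> touch p g -> connect (tour p) f g.
Proof.
have [N ltN] : exists N, forall q, r q < N.
  by exists (\max_q r q).+1 => q; rewrite ltnS; exact: leq_bigmax.
(* Children have larger [r], so the induction runs from the leaves upwards. *)
have [k] := ubnP (N - r p); elim: k p f g => // k IH p f g ltk.
have sym := tour_sym p; have csym := sym_connect_sym sym.
have child q : up q = Some p -> forall f g, touch q f -> touch q g -> connect (tour p) f g.
  move=> qp f' g' qf qg; have dqp : desc q p by apply: connect1; rewrite /= qp.
  have : connect (tour q) f' g' by apply: IH => //; have := r_up qp; have := ltN q; lia.
  apply: connect_sub => a b /and3P[qa qb ab]; apply: connect1; apply/and3P.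
  by split=> //; exact: touch_desc dqp _.
have pp : desc p p by exact: connect0.
have around x : x != pd p ->
    connect (tour p) (edge_end false (side p x)) (edge_end true (side p x)).
  move=> nx; have [inA|] := boolP (side p x \in cotree).
    apply: connect1; apply/and3P; split.
    - by rewrite edge_end_side; exact: touch_corner.
    - by rewrite edge_end_side; exact: touch_corner.
    by apply/existsP; exists (side p x); rewrite inA !eqxx.
  rewrite inE negbK => /imsetP[q _ pq].
  case: (eq_side pq) => [[eqp xE]|[pxq qd]]; first by move: nx; rewrite xE eqp eqxx.
  have qp : up q = Some p by rewrite /up qd; exact: nbr_opp.
  by apply: (child q qp); rewrite pq edge_end_side; apply: touch_corner; exact: connect0.
(* Three sides of a square still form a path through its four corners. *)
have corners c c' : connect (tour p) (corner p c) (corner p c').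
  suff H c0 : connect (tour p) (corner p (false, false)) (corner p c0).
    by apply: connect_trans (H c'); rewrite csym.
  have ff := connect0 (tour p) (corner p (false, false)).
  have a1 := around (true, false); have a2 := around (true, true).
  have a3 := around (false, false); have a4 := around (false, true).
  rewrite !edge_end_side /= in a1 a2 a3 a4.
  case: (pd p) a1 a2 a3 a4 => -[] [] a1 a2 a3 a4.
  - have {}a1 := a1 isT; have {}a3 := a3 isT; have {}a4 := a4 isT.
    case: c0 => -[] [] //; [exact: connect_trans a1 a4].
  - have {}a2 := a2 isT; have {}a3 := a3 isT; have {}a4 := a4 isT.
    have b := connect_trans a3 a2.
    case: c0 => -[] [] //; apply: connect_trans b _; by rewrite csym.
  - have {}a1 := a1 isT; have {}a2 := a2 isT; have {}a3 := a3 isT.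
    case: c0 => -[] [] //; exact: connect_trans a3 a2.
  - have {}a1 := a1 isT; have {}a2 := a2 isT; have {}a4 := a4 isT.
    have b := connect_trans a1 a4.
    case: c0 => -[] [] //; apply: connect_trans b _; by rewrite csym.
suff H f0 : touch p f0 -> connect (tour p) (corner p (false, false)) f0.
  by move=> /H Hf /H Hg; apply: connect_trans Hg; rewrite csym.
case/existsP=> q /andP[/connect_last[->|[q1 qq1 /eqP q1p]] /existsP[c /eqP<-]] //.
(* The cell [q] lies below the child [q1], which shares a side with [p]; an end of that side is a
   common corner, from which the subtree of [q1] can be toured. *)
have pE := edge_end_side false p (opp (pd q1)).
rewrite (proj1 (nbrP _ _ _) q1p) edge_end_side in pE.
have {pE} [c1 [c2 pE]] : exists c1 c2, corner q1 c1 = corner p c2 by do 2!eexists; exact: pE.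
apply: connect_trans (corners _ c2) _; rewrite -pE.
by apply: (child _ q1p); apply: touch_corner => //; exact: connect0.
Qed.

(** Both ends of a side are corners of one cell, so touring the subtree below that cell joins
    them. *)
Lemma cotree_connected f g : connect cotree_adj f g.
Proof.
apply: connect_face => [|e]; first exact: cotree_adj_sym.
have [p [x <-]] := gedge_is_side e; rewrite !edge_end_side.
have pp : desc p p by exact: connect0.
apply: connect_sub (touch_connected (touch_corner _ pp) (touch_corner _ pp)).
by move=> a b /and3P[_ _]; exact: connect1.
Qed.

Lemma desc_total p q q' : desc p q -> desc p q' -> desc q q' \/ desc q' q.
Proof.
move=> /connectP[s]; elim: s p => [|a s IH] p /=; first by move=> _ ->; left.
case/andP=> /eqP pa pth lst /connectP[[|b s'] /=].
  by move=> _ ->; right; apply/connectP; exists (a :: s); rewrite //= pa eqxx.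
case/andP=> /eqP pb pth' lst'; apply: (IH a pth lst).
by move: pb; rewrite pa => -[->]; apply/connectP; exists s'.
Qed.

End Tree.

(** * Bags at the corners and their size on each level *)

Section Decomposition.

Variables (pd : cell -> dir) (r lv : cell -> nat) (V : finType) (top : V -> cell).
Hypothesis r_up : forall p q, nbr p (pd p) = Some q -> r q < r p.
Hypothesis lv_up : forall p q, nbr p (pd p) = Some q -> lv q <= lv p.
Hypothesis lv_top : forall v q, nbr (top v) (pd (top v)) = Some q -> lv q < lv (top v).
Hypothesis top_inj : injective top.

Let bag v f := touch pd (top v) f.

Lemma desc_lv p q : desc pd p q -> lv q <= lv p.
Proof.
move=> /connectP[s]; elim: s p => [|a s IH] p /=; first by move=> _ ->.
by case/andP=> /eqP pa pth /(IH _ pth) H; apply: leq_trans H (lv_up pa).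
Qed.

(** The first step up from [top v] lowers the level, and no later step regains it. *)
Lemma desc_top v w : desc pd (top v) (top w) -> lv (top v) = lv (top w) -> v = w.
Proof.
move=> /connectP[[|a s] /=]; first by move=> _ /top_inj.
case/andP=> /eqP va pth lst lvE; have := lv_top va; rewrite lvE ltnNge desc_lv //.
by apply/connectP; exists s.
Qed.

(** Each vertex of the bag is charged to one of the four cells around [f]. Tops charged to the same
    cell lie on its root path, hence are comparable, and equal levels make them equal. *)
Lemma card_bag_level f l : #|[set v | bag v f & lv (top v) == l]| <= 4.
Proof.
have cornerP v : exists pc : option (cell * (bool * bool)), bag v f ->
    if pc is Some (p, c) then desc pd p (top v) /\ corner p c = f else False.
  have [/existsP[p /andP[pv /existsP[c /eqP cf]]]|] := boolP (bag v f).
    by exists (Some (p, c)).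
  by exists None.
have [h hP] := boolp.choice cornerP.
pose g v := if h v is Some (p, c) then c else (true, true).
have inj : {in [set v | bag v f & lv (top v) == l] &, injective g}.
  move=> v w; rewrite !inE /g => /andP[/hP + /eqP lv_v] /andP[/hP + /eqP lv_w].
  case: (h v) => // -[p c] [pv pf]; case: (h w) => // -[q c'] [qw qf] cE.
  subst c'; have pq : p = q.
    move: qf; rewrite -pf; case: p q {pf pv qw} => p1 p2 [q1 q2] [].
    by move=> /bshift_inj-> /bshift_inj->.
  subst q; have [vw|wv] := desc_total pv qw.
    by apply: desc_top vw _; rewrite lv_v.
  by apply/esym; apply: desc_top wv _; rewrite lv_v.
rewrite -(card_in_imset inj); apply: leq_trans (max_card _) _.
by rewrite card_prod card_bool.
Qed.

(** Counting turns the connected cotree into the tree on the corners. For the last clause, an end of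
    the side common to two adjacent cells is a corner of both, so its bag holds the vertices above
    either cell. *)
Theorem grid_tree_decomposition :
  exists (par : face -> face) (d : face -> nat) (S : V -> pred face),
  [/\ forall f, par f = f \/ d (par f) < d f,
      forall v, exists f, S v f,
      forall v f g, S v f -> S v g ->
        connect [rel f g | [&& S v f, S v g & (par f == g) || (par g == f)]] f g,
      forall f l, #|[set v | S v f & lv (top v) == l]| <= 4 &
      forall v w p q x, desc pd p (top v) -> desc pd q (top w) -> nbr p x = Some q ->
        exists f, S v f && S w f].
Proof.
have [par [d [dpar parA]]] := connected_card_tree (card_cotree r_up) (cotree_connected r_up).
exists par, d, bag; split=> //.
- move=> v; exists (corner (top v) (true, true)); apply: touch_corner; exact: connect0.
- move=> v f g vf vg; apply: connect_sub (touch_connected r_up vf vg).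
  move=> a b /and3P[va vb /existsP[e /andP[/parA eA ab]]]; apply: connect1.
  rewrite /= /bag va vb /=; case/orP: ab => /andP[/eqP <- /eqP <-].
    by case: eA => ->; rewrite eqxx ?orbT.
  by case: eA => ->; rewrite eqxx ?orbT.
- exact: card_bag_level.
- move=> v w p q x pv qw /nbrP pq; exists (edge_end true (side p x)).
  apply/andP; split; first by rewrite edge_end_side; exact: touch_corner.
  by rewrite -pq edge_end_side; exact: touch_corner.
Qed.

End Decomposition.

End Grid.

(** * From a labelling of the cells to a levelled tree decomposition *)

Definition cell_adj n : rel (cell n) := [rel p q | [exists x, nbr p x == Some q]].

Lemma exists_boundary_cell n (p : cell n) :
  exists q, exists2 x, connect (@cell_adj n) p q & nbr q x = None.
Proof.
have [m] := ubnP (val p.1); elim: m p => // m IH p ltm.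
case E: (nbr p (false, false)) => [q|]; last by exists p, (false, false); rewrite ?connect0.
have ltqp : q.1 < p.1.
  have /nbrP/(congr1 snd) H : nbr p (false, false) = Some q := E.
  have {H} : bshift true q.1 = bshift false p.1 := H.
  by move=> /(congr1 (@nat_of_ord _)); rewrite !val_bshift addn0 addn1 => <-.
have [|q' [x qq' q'x]] := IH q; first by apply: leq_trans ltqp _; rewrite -ltnS.
exists q', x => //; apply: connect_trans qq'; apply: connect1.
by apply/existsP; exists (false, false); rewrite E.
Qed.

(** Levels are distances of label classes from the outside. Each class gets one root cell with a
    side facing the outside or a class of smaller level; a search inside the class joins its other
    cells to that root. *)
Lemma labelled_grid_decomposition n (T : finType) (lab : cell n -> option T) (G : rel T) :
  (forall x, exists p, lab p = Some x) ->
  (forall p q x, lab p = Some x -> lab q = Some x ->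
     connect [rel p q | [&& @cell_adj n p q, lab p == Some x & lab q == Some x]] p q) ->
  (forall x y, G x y -> exists p q, [/\ lab p = Some x, lab q = Some y & cell_adj p q]) ->
  exists (par : face n -> face n) (d : face n -> nat) (S : T -> pred (face n)) (lev : T -> nat),
  [/\ [/\ forall f, par f = f \/ d (par f) < d f,
          forall v, exists f, S v f &
          forall v f g, S v f -> S v g ->
        connect [rel f g | [&& S v f, S v g & (par f == g) || (par g == f)]] f g],
      forall f l, #|[set v | S v f & lev v == l]| <= 4,
      forall v w, G v w -> exists f, S v f && S w f &
      forall v w, G v w -> lev v <= (lev w).+1].
Proof.
move=> lab_surj lab_conn G_adj.
(* A cell without label becomes a vertex of its own. *)
pose lb p : T + cell n := if lab p is Some x then inl x else inr p.
have lb_inl p x : lb p = inl x <-> lab p = Some x.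
  by rewrite /lb; case: (lab p) => [y|]; split=> // -[->].
have lb_conn p q : lb p = lb q -> connect [rel p q | cell_adj p q && (lb p == lb q)] p q.
  case E: (lab q) => [x|]; last first.
    rewrite {2}/lb E /lb; case: (lab p) => // -[->]; exact: connect0.
  move=> pq; have lq : lb q = inl x by apply/lb_inl.
  have lp : lab p = Some x by apply/lb_inl; rewrite pq.
  apply: connect_sub (lab_conn _ _ _ lp E) => a b /and3P[ab /eqP/lb_inl la /eqP/lb_inl lb'].
  by apply: connect1; rewrite /= ab la lb' eqxx.
pose eL := [rel l l' | [exists p, exists q, [&& lb p == l, lb q == l' & cell_adj p q]]].
(* Values carried by no cell count as roots, so that every value has a distance. *)
pose rootL l := [exists p, [exists x, (lb p == l) && (nbr p x == None)]] || [forall p, lb p != l].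
have eL_lb p q : connect (@cell_adj n) p q -> connect eL (lb p) (lb q).
  move=> /connectP[s]; elim: s p => [|a s IH] p /=; first by move=> _ ->; exact: connect0.
  move=> /andP[pa pth lst]; apply: connect_trans (IH a pth lst); apply: connect1.
  by apply/existsP; exists p; apply/existsP; exists a; rewrite !eqxx.
have [|dL [dL_step dL_le]] := @exists_distance _ eL rootL.
  move=> l; case: (boolP [forall p, lb p != l]) => [unused|].
    by exists l; rewrite ?connect0 // /rootL unused orbT.
  rewrite negb_forall => /existsP[p]; rewrite negbK => /eqP <-.
  have [q [x pq qx]] := exists_boundary_cell p; exists (lb q); last exact: eL_lb.
  apply/orP; left; apply/existsP; exists q; apply/existsP; exists x.
  by rewrite qx !eqxx.
(* For a label that occurs, the pair is the root cell of its class and the direction in which the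
   tree leaves the class. *)
have hE l : exists o : option (cell n * dir), (exists p, lb p = l) ->
    exists t x, [/\ o = Some (t, x), lb t = l &
      forall q, nbr t x = Some q -> dL (lb q) < dL l].
  case: (boolP [forall p, lb p != l]) => [/forallP unused|used].
    by exists None => -[p pl]; have := unused p; rewrite pl eqxx.
  case: (boolP (rootL l)) => [|nroot].
    rewrite /rootL (negbTE used) orbF => /existsP[p /existsP[x /andP[/eqP pl /eqP px]]].
    by exists (Some (p, x)) => _; exists p, x; rewrite px.
  have [l' /existsP[p /existsP[q /and3P[/eqP pl /eqP ql' /existsP[x /eqP pxq]]]] dl] := dL_step _ nroot.
  exists (Some (p, x)) => _; exists p, x; split=> // q'; rewrite pxq => -[<-].
  by rewrite ql' dl.
have [h hP] := boolp.choice hE.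
have hlb p := hP (lb p) (ex_intro _ p erefl).
pose root p := if h (lb p) is Some (t, _) then p == t else false.
have [|d2 [d2_step _]] := @exists_distance _ [rel p q | cell_adj p q && (lb p == lb q)] root.
  move=> p; have [t [x [hp tp _]]] := hlb p; exists t; first by rewrite /root tp hp.
  exact: lb_conn.
have pdE p : exists x, if root p then h (lb p) = Some (p, x) else
    exists q, [/\ nbr p x = Some q, lb q = lb p & d2 p = (d2 q).+1].
  case: (boolP (root p)) => [|nroot].
    by have [t [x [hp _ _]]] := hlb p; rewrite /root hp => /eqP->; exists x.
  have [q /andP[/existsP[x /eqP pq] /eqP lpq] dp] := d2_step _ nroot.
  by exists x, q.
have [pd pdP] := boolp.choice pdE.
have pd_root p q : root p -> nbr p (pd p) = Some q -> dL (lb q) < dL (lb p).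
  move=> rp; have := pdP p; rewrite rp; have [t [x [-> _ H]]] := hlb p.
  by case=> pt <- pq; apply: H; rewrite pt.
have pd_nroot p q : ~~ root p -> nbr p (pd p) = Some q -> lb q = lb p /\ d2 p = (d2 q).+1.
  by move=> nrp; have := pdP p; rewrite (negbTE nrp) => -[q' [-> ? ?]] [<-].
have topE x : exists t, root t /\ lb t = inl x.
  have [p /lb_inl px] := lab_surj x; have [t [y [ht lt _]]] := hlb p.
  by exists t; rewrite /root lt ht eqxx px.
have [top topP] := boolp.choice topE.
have [N ltN] : exists N, forall p, d2 p < N.
  by exists (\max_p d2 p).+1 => p; rewrite ltnS; exact: leq_bigmax.
(* Since [N] exceeds every [d2], this rank is lexicographic: first the level, then the distance to
   the root cell. *)
have r_up p q : nbr p (pd p) = Some q -> dL (lb q) * N + d2 q < dL (lb p) * N + d2 p.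
  move=> pq; case: (boolP (root p)) => [rp|nrp].
    have := pd_root _ _ rp pq; have := ltN q; nia.
  by have [-> ->] := pd_nroot _ _ nrp pq; rewrite addnS.
have lv_up p q : nbr p (pd p) = Some q -> dL (lb q) <= dL (lb p).
  move=> pq; case: (boolP (root p)) => [rp|nrp]; first exact/ltnW/pd_root.
  by have [->] := pd_nroot _ _ nrp pq.
have lv_top v q : nbr (top v) (pd (top v)) = Some q -> dL (lb q) < dL (lb (top v)).
  by apply: pd_root; case: (topP v).
have top_inj : injective top.
  by move=> x y xy; have [_] := topP x; rewrite xy; have [_ ->] := topP y => -[].
have desc_top p v : lb p = inl v -> desc pd p (top v).
  have [m] := ubnP (d2 p); elim: m p => // m IH p ltm pv.
  case: (boolP (root p)) => [|nrp].
    have [rt tv] := topP v; move: rt; rewrite /root pv tv.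
    by case: (h _) => // -[t x] /eqP-> /eqP->; exact: connect0.
  have := pdP p; rewrite (negbTE nrp) => -[q [pq qp dp]].
  apply: connect_trans (IH q _ _); last 2 first.
  - by move: ltm; rewrite dp.
  - by rewrite qp.
  by apply: connect1; rewrite /= /up pq.
have [par [d [S [dpar S0 Sc S4 Sadj]]]] := grid_tree_decomposition r_up lv_up lv_top top_inj.
exists par, d, S, (fun v => dL (lb (top v))); split=> // v w /G_adj[p [q [/lb_inl pv /lb_inl qw pq]]].
- by have /existsP[x /eqP px] := pq; apply: Sadj px; exact: desc_top.
- have [_ ->] := topP v; have [_ ->] := topP w; apply: dL_le.
  by apply/existsP; exists p; apply/existsP; exists q; rewrite pv qw !eqxx.
Qed.

(** * Clique cover width and the two graphs *)

Lemma sorted_ltn_nth_sub (s : seq nat) i j : sorted ltn s ->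
  i <= j < size s -> nth 0 s i + (j - i) <= nth 0 s j.
Proof.
move=> ss; elim: j => [|j IH]; first by rewrite leqn0 => /andP[/eqP-> _]; rewrite addn0.
case/andP; rewrite leq_eqVlt => /orP[/eqP->|]; first by rewrite subnn addn0.
rewrite ltnS => le_ij ltj; rewrite subSn // addnS.
apply: leq_ltn_trans (IH _) _; first by rewrite le_ij ltnW.
exact: (sorted_ltn_nth ltn_trans 0 ss _ _ (ltnW ltj) ltj).
Qed.

(** The fibres of [key], in increasing order, form the cover. Keys that do not occur are skipped,
    which only brings the blocks closer. *)
Lemma CCW_le_key (T : finType) (G : sgraph T) (key : T -> nat) w :
  (forall x y, x != y -> key x = key y -> G x y) ->
  (forall x y, G x y -> key x <= key y + w) -> CCW G <= w.
Proof.
move=> same_key adj_key.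
pose s := sort leq (undup [seq key x | x <- enum T]).
have s_sorted : sorted ltn s.
  by rewrite ltn_sorted_uniq_leq sort_uniq undup_uniq (sort_sorted leq_total).
have mem_s k : (k \in s) = [exists x, key x == k].
  rewrite mem_sort mem_undup; apply/mapP/existsP => [[x _ ->]|[x /eqP<-]]; exists x => //.
  by rewrite mem_enum.
pose cls k := [set x | key x == k].
pose C := [seq cls k | k <- s].
have cls_key x : x \in cls (key x) by rewrite inE.
have key_cls k x : x \in cls k -> key x = k by rewrite inE => /eqP.
have cover_C : ordered_clique_cover G C.
  apply/and3P; split.
  - rewrite map_inj_in_uniq ?sort_uniq ?undup_uniq // => k l.
    by rewrite mem_s => /existsP[x /eqP<-] _ kl; apply: key_cls; rewrite -kl.
  - apply/and3P; split.
    + rewrite eqEsubset subsetT; apply/subsetP => x _; apply/bigcupP.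
      exists (cls (key x)) => //; rewrite inE; apply: map_f; rewrite mem_s.
      by apply/existsP; exists x.
    + apply/trivIsetP => X Y; rewrite !inE => /mapP[k _ ->] /mapP[l _ ->] kl.
      apply/pred0P => x /=; apply/negP => /andP[/key_cls xk /key_cls xl].
      by move: kl; rewrite -xk -xl eqxx.
    + rewrite inE; apply/negP => /mapP[k]; rewrite mem_s => /existsP[x /eqP<-] /setP/(_ x).
      by rewrite cls_key inE.
  - apply/allP => X /mapP[k _ ->]; apply/forall_inP => x /key_cls xk.
    by apply/forall_inP => y /key_cls yk; apply/implyP => xy; apply: same_key; rewrite ?xk.
suff W : width G C <= w.
  rewrite /CCW; case: ex_minnP => m _ minm; apply: leq_trans W; apply: minm.
  by apply/boolp.asboolP; exists C.
have keyP (i : 'I_(size C)) x : x \in nth set0 C i -> key x = nth 0 s i.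
  by rewrite (nth_map 0) ?(leq_trans (ltn_ord i)) ?size_map // => /key_cls.
have dist (i j : 'I_(size C)) x y : x \in nth set0 C i -> y \in nth set0 C j -> G x y ->
    i <= j -> j - i <= w.
  move=> /keyP xi /keyP yj xy le_ij; have := adj_key y x; rewrite adj_sym => /(_ xy).
  have := @sorted_ltn_nth_sub s i j s_sorted; rewrite le_ij.
  have ltj : j < size s by apply: leq_trans (ltn_ord j) _; rewrite size_map.
  by rewrite ltj => /(_ isT); rewrite xi yj; lia.
apply/bigmax_leqP => i _; apply/bigmax_leqP => j /existsP[x /andP[xi /existsP[y /andP[yj xy]]]].
have := dist i j x y xi yj xy; have := dist j i y x yj xi; rewrite adj_sym => /(_ xy).
have [le|/ltnW le] := leqP i j => H1 H2.
  by have := H2 isT; lia.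
by have := H1 le; lia.
Qed.

(** Colours are below 4, so pairs with equal [key] agree in level and colour. The colouring keeps
    such pairs out of [G2], so adding them to [G1] does not change the intersection. *)
Lemma labelled_grid_intersection n (T : finType) (G : sgraph T) (lab : cell n -> option T) :
  (forall x, exists p, lab p = Some x) ->
  (forall p q x, lab p = Some x -> lab q = Some x ->
     connect [rel p q | [&& @cell_adj n p q, lab p == Some x & lab q == Some x]] p q) ->
  (forall x y, G x y -> exists p q, [/\ lab p = Some x, lab q = Some y & cell_adj p q]) ->
  exists G1 G2 : sgraph T,
    [/\ CCW G1 <= 7, chordal G2 & forall x y : T, G x y = G1 x y && G2 x y].
Proof.
move=> H1 H2 H3.
have [par [d [S [lev [[dpar S0 Sc] S4 Gbag Glev]]]]] := labelled_grid_decomposition H1 H2 H3.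
have [col colP] := share_bag_colouring dpar S0 Sc S4.
pose key x := 4 * lev x + col x.
have keyE x y : key x = key y -> lev x = lev y /\ col x = col y.
  rewrite /key => xy; have := ltn_ord (col x); have := ltn_ord (col y) => cx cy.
  by split; [|apply/val_inj => /=]; lia.
have Gxx x : G x x = false by exact: adj_irr.
pose e1 := [rel x y | (x != y) && (G x y || (key x == key y))].
have e1s : symmetric e1 by move=> x y; rewrite /= eq_sym adj_sym [key x == _]eq_sym.
have e1i : irreflexive e1 by move=> x; rewrite /= eqxx.
have e2i : irreflexive (share_bag S) by move=> x; rewrite /share_bag /= eqxx.
exists (SGraph e1s e1i), (SGraph (@share_bag_sym _ _ S) e2i); split.
- apply: (@CCW_le_key _ _ key) => [x y xy kxy|x y /=]; first by rewrite /= xy kxy eqxx orbT.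
  case/andP=> _ /orP[/Glev le|/eqP->]; last by rewrite leq_addr.
  by have := ltn_ord (col x); rewrite /key; lia.
- move=> p szp [Up cp chord]; have := share_bag_chordal dpar S0 Sc Up cp chord; lia.
- move=> x y /=; case: (eqVneq x y) => [->|xy]; first by rewrite Gxx.
  have [Gxy|nGxy] /= := boolP (G x y); first by rewrite /share_bag /= xy; apply/esym/existsP/Gbag.
  apply/esym/negP => /andP[/eqP/keyE[lxy cxy] sxy].
  by have := colP x y sxy lxy; rewrite cxy eqxx.
Qed.

(** * From walks in the grid to a labelling *)

Lemma cell_adj_sym n : symmetric (@cell_adj n).
Proof.
by move=> p q; apply/existsP/existsP => -[x /eqP/nbr_opp H]; exists (opp x); rewrite H.
Qed.

(* The walk [w x y] follows the arc from [x] to [y]; its first and last thirds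
   go to [x] and [y], and its middle third goes to [x] until it first hits the
   cells already given to [y]. *)
Lemma walks_labelling n (T : finType) (H : rel T) (m : nat) (pt : T -> cell n)
    (w : T -> T -> nat -> cell n) (on1 : T -> cell n -> Prop) (on2 : T -> T -> cell n -> Prop) :
  (forall x y, H x y -> w x y 0 = pt x /\ w x y (3 * m) = pt y) ->
  (forall x y k, H x y -> k < 3 * m -> w x y k = w x y k.+1 \/ cell_adj (w x y k) (w x y k.+1)) ->
  (forall x, on1 x (pt x)) ->
  (forall x y k, H x y -> k <= m -> on1 x (w x y k)) ->
  (forall x y k, H x y -> m <= k <= 2 * m -> on2 x y (w x y k)) ->
  (forall x y k, H x y -> 2 * m <= k <= 3 * m -> on1 y (w x y k)) ->
  (forall u v c, on1 u c -> on1 v c -> u = v) ->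
  (forall u x y c, on1 u c -> on2 x y c -> u = x \/ u = y) ->
  (forall x y u v c, H x y -> H u v -> on2 x y c -> on2 u v c -> x = u) ->
  (forall x, ~~ H x x) ->
  exists lab : cell n -> option T,
  [/\ forall x, exists p, lab p = Some x,
      forall p q x, lab p = Some x -> lab q = Some x ->
        connect [rel p q | [&& @cell_adj n p q, lab p == Some x & lab q == Some x]] p q &
      forall x y, H x y || H y x -> exists p q, [/\ lab p = Some x, lab q = Some y & cell_adj p q]].
Proof.
move=> w_ends w_adj pt_on w_fst w_mid w_lst on11 on12 on22 H_irr.
pose star v c := [\/ c = pt v, exists y k, [/\ H v y, k <= m & c = w v y k] |
  exists x k, [/\ H x v, 2 * m <= k <= 3 * m & c = w x v k]].
have star_on v c : star v c -> on1 v c.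
  by case=> [->|[y [k [? ? ->]]]|[x [k [? ? ->]]]]; [exact: pt_on|exact: w_fst|exact: w_lst].
pose own v c := star v c \/ exists y k, [/\ H v y, m <= k <= 2 * m, c = w v y k &
  forall l, m <= l <= k -> ~ star y (w v y l)].
have own_uniq u v c : own u c -> own v c -> u = v.
  (* A star cell on the middle third of a walk from [b] to [y] is in the star of [b] or of [y], and
     the stretch owned by [b] stops before the star of [y]. *)
  have mix a b : star a c -> (exists y k, [/\ H b y, m <= k <= 2 * m, c = w b y k &
      forall l, m <= l <= k -> ~ star y (w b y l)]) -> a = b.
    move=> ac [y [k [by_ km cE nstar]]].
    have [//|ay] : a = b \/ a = y.
      by apply: (on12 _ _ _ c); [exact: star_on | rewrite cE; exact: w_mid].
    by case: (nstar k); rewrite -?cE -?ay //; lia.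
  case=> [uc|uc] [vc|vc]; [exact: on11 (star_on _ _ uc) (star_on _ _ vc)|exact: mix|exact/esym/mix|].
  have [y [k [uy km cE _]]] := uc; have [z [l [vz lm cE' _]]] := vc.
  by apply: (on22 u y v z c) => //; [rewrite cE|rewrite cE']; exact: w_mid.
pose lab c := [pick v | boolp.asbool (own v c)].
have labP c v : lab c = Some v <-> own v c.
  rewrite /lab; split; first by case: pickP => // u /boolp.asboolP uc [<-].
  move=> vc; case: pickP => [u /boolp.asboolP uc|/(_ v)/boolp.asboolP//].
  by rewrite (own_uniq _ _ _ uc vc).
have own_pt v : own v (pt v) by left; constructor 1.
exists lab; split=> [x|p q x px qx|].
- by exists (pt x); apply/labP.
- set r := [rel _ _ | _].
  have rsym : symmetric r by move=> a b; rewrite /= cell_adj_sym [(lab a == _) && _]andbC.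
  have walk y z i j : H y z -> i <= j -> j <= 3 * m ->
      (forall k, i <= k <= j -> own x (w y z k)) -> connect r (w y z i) (w y z j).
    move=> yz; elim: j => [|j IH]; first by rewrite leqn0 => /eqP->.
    rewrite leq_eqVlt => /orP[/eqP->//|lt_ij ltj ok].
    apply: connect_trans (IH _ _ _) _ => //; [exact: ltnW| |].
      by move=> k /andP[ik kj]; apply: ok; rewrite ik leqW.
    have [->|adj] := w_adj _ _ _ yz ltj; first exact: connect0.
    apply: connect1; apply/and3P; split=> //; apply/eqP/labP; apply: ok; lia.
  suff to_pt c : own x c -> connect r (pt x) c.
    move/labP/to_pt: px => px; move/labP/to_pt: qx => qx.
    by apply: connect_trans qx; rewrite (sym_connect_sym rsym).
  have fst_third y k : H x y -> k <= m -> connect r (pt x) (w x y k).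
    move=> xy km; have [<- _] := w_ends _ _ xy; apply: walk => //; first by lia.
    move=> l /andP[_ lk]; left; constructor 2; exists y, l; split=> //; lia.
  case=> [[->|[y [k [xy km ->]]]|[y [k [yx km ->]]]]|[y [k [xy km -> nstar]]]].
  + exact: connect0.
  + exact: fst_third.
  + have [_ <-] := w_ends _ _ yx; rewrite (sym_connect_sym rsym); apply: walk => //; first by lia.
    move=> l lk; left; constructor 3; exists y, l; split=> //; lia.
  + apply: connect_trans (fst_third y m xy (leqnn _)) _; apply: walk => //; [lia|lia|].
    move=> l lk; right; exists y, l; split=> //; first by lia.
    by move=> l' ll'; apply: nstar; lia.
- have main x y : H x y -> exists p q, [/\ lab p = Some x, lab q = Some y & cell_adj p q].
    (* Index [2 * m] is in the star of [y], so there is a first hit; it comes after [m], where the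
       walk is still in the star of [x]. The cell just before it is owned by [x]. *)
    move=> xy; have ex : exists k, boolp.asbool (m <= k /\ star y (w x y k)).
      exists (2 * m); apply/boolp.asboolP; split; first by lia.
      by constructor 3; exists x, (2 * m); split=> //; lia.
    case: (ex_minnP ex) => k /boolp.asboolP[mk stk] mink.
    have k2m : k <= 2 * m.
      apply: mink; apply/boolp.asboolP; split; first by lia.
      by constructor 3; exists x, (2 * m); split=> //; lia.
    have nxy : x <> y by move=> E; have := H_irr x; rewrite {2}E xy.
    have ltmk : m < k.
      rewrite ltn_neqAle mk andbT; apply/eqP => E; apply: nxy.
      by apply: (on11 _ _ (w x y k)); [rewrite -E; exact: w_fst | exact: star_on].
    case: k mk stk mink k2m ltmk => // k mk stk mink k2m ltmk.
    have ownx : own x (w x y k).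
      right; exists y, k; split=> //; first by lia.
      move=> l lk stl; have : k < l by apply: mink; apply/boolp.asboolP; split=> //; lia.
      by lia.
    have owny : own y (w x y k.+1) by left.
    exists (w x y k), (w x y k.+1); split; [exact/labP|exact/labP|].
    have [|E|//] := w_adj x y k xy; first by lia.
    by case: nxy; apply: own_uniq ownx _; rewrite E.
  move=> x y; case/orP=> [/main//|/main[p [q [py qx pq]]]].
  by exists q, p; split=> //; rewrite cell_adj_sym.
Qed.

Lemma cell_adj_or n (p q : cell n) :
  (p.1 = q.1 /\ p.2 <= q.2.+1 /\ q.2 <= p.2.+1) \/ (p.2 = q.2 /\ p.1 <= q.1.+1 /\ q.1 <= p.1.+1) ->
  p = q \/ cell_adj p q.
Proof.
case: p q => p1 p2 [q1 q2] /= pq.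
have [<-|ne] := eqVneq (p1, p2) (q1, q2); [by left | right].
have stp b (i j : 'I_n) : (if b then j = i.+1 :> nat else i = j.+1 :> nat) -> step b i = Some j.
  move=> ij; apply/stepP/val_inj; rewrite /= !val_bshift; by case: b ij => /= ->; lia.
case: pq => [[E [le1 le2]]|[E [le1 le2]]]; subst.
- have {}ne : p2 <> q2 :> nat by move=> /val_inj E; rewrite E eqxx in ne.
  apply/existsP; exists (true, p2 < q2); rewrite /nbr /= (stp _ _ q2) //.
  by case: ltnP; lia.
- have {}ne : p1 <> q1 :> nat by move=> /val_inj E; rewrite E eqxx in ne.
  apply/existsP; exists (false, p1 < q1); rewrite /nbr /= (stp _ _ q1) //.
  by case: ltnP; lia.
Qed.

(* Compactness, arcs and rounding *)
From mathcomp Require Import all_order all_algebra lra.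
From mathcomp Require Import all_classical all_reals all_analysis.
Import Order.TTheory GRing.Theory Num.Theory numFieldNormedType.Exports.

Local Open Scope classical_set_scope.
Local Open Scope ring_scope.

(** The near-covering form of compactness, applied to the product of [A] and [B], makes the gap
    around each pair uniform. *)
Lemma compact_gap (R : realType) (V : normedModType R) (A B : set V) :
  compact A -> compact B -> A `&` B = set0 ->
  \forall e \near (0 : R)^'+, forall a b, A a -> B b -> ~ ball a e b.
Proof.
move=> cA cB AB0.
have /compact_near_coveringP cov := compact_setX cA cB.
have := cov R (0 : R)^'+ (fun e p => ~ ball p.1 e p.2) _.
case=> [|e /= e0 H].
  case=> a b /= [Aa Bb].
  have d0 : 0 < `|a - b|.
    rewrite normr_gt0 subr_eq0; apply/eqP => ab.
    have aAB : (A `&` B) a by split=> //; rewrite ab.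
    by rewrite AB0 in aAB.
  (* Quarters, because three such hops cannot cover the distance from [a] to [b]. *)
  exists (ball (a, b) (`|a - b| / 4), [set e | e < `|a - b| / 4]) => /=.
    split; first by apply: nbhsx_ballx; lra.
    by apply: nbhs_right_lt; lra.
  case=> -[a' b'] e /= [[/= aa bb] lt_e] ab'.
  have : ball a (`|a - b| / 4 + e + `|a - b| / 4) b.
    by apply: ball_triangle (ball_sym bb); exact: ball_triangle ab'.
  rewrite -ball_normE /=; lra.
exists e => // x xe x0 a b Aa Bb; exact: (H x xe x0 (a, b)).
Qed.

(** Continuity on the whole line lets [t] leave the segment; compactness is applied to [s] only. *)
Lemma uniform_continuity_segment (R : realType) (V : normedModType R) (f : R -> V) (a b d : R) :
  continuous f -> 0 < d ->
  \forall e \near (0 : R)^'+, forall s t, a <= s <= b -> `|s - t| < e -> ball (f s) d (f t).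
Proof.
move=> cf d0.
have /compact_near_coveringP cov := @segment_compact R a b.
have := cov R (0 : R)^'+ (fun e s => forall t, `|s - t| < e -> ball (f s) d (f t)) _.
case=> [|e /= e0 H].
  move=> x _; have d2 : 0 < d / 2 by lra.
  have [r r0 fr] : nbhs x [set y | ball (f x) (d / 2) (f y)].
    by apply: (cf x); exact: nbhsx_ballx.
  rewrite /= in r0; exists (ball x (r / 2), [set e | e < r / 2]) => /=.
    split; first by apply: nbhsx_ballx; lra.
    by apply: nbhs_right_lt; lra.
  case=> s e /= [xs lt_e] t st.
  have xs' : ball x r s by apply: le_ball xs; lra.
  have xt : ball x r t.
    apply: le_ball (_ : r / 2 + e <= r) _ _; first by lra.
    by apply: ball_triangle xs _; rewrite -ball_normE.
  rewrite [d]splitr; apply: ball_triangle (fr t xt).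
  exact/ball_sym/fr.
exists e => // x xe x0 s t sab; apply: (H x xe x0).
by rewrite /= in_itv.
Qed.

Lemma jordan_arc_param (R : realType) (a b : R * R) A : jordan_arc a b A ->
  exists f : R -> R * R, [/\ continuous f, f 0 = a, f 1 = b,
    forall s t, 0 <= s <= 1 -> 0 <= t <= 1 -> f s = f t -> s = t &
    forall t, 0 <= t <= 1 -> A (f t)].
Proof.
case=> f [fc fi f0 f1 ->].
(* Clamping to the unit segment extends the arc continuously to the whole line. *)
pose cl (t : R) : R := Num.max 0 (Num.min t 1).
have clP t : cl t \in `[0, 1].
  by rewrite in_itv /= /cl le_max lexx /= ge_max ler01 /= ge_min lexx orbT.
have clE t : 0 <= t <= 1 -> cl t = t.
  by rewrite /cl => /andP[t0 t1]; rewrite (min_idPl t1) (max_idPr t0).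
have clc : continuous cl.
  move=> t; apply: (@continuous_max R R (cst 0) (fun t => Num.min t 1)); first exact: cvg_cst.
  by apply: (@continuous_min R R id (cst 1)); [exact: cvg_id | exact: cvg_cst].
exists (f \o cl); split.
- move=> t; have /subspace_continuousP/(_ (cl t)) := fc; rewrite /= => /(_ (clP t)) H.
  move=> P /H HP; have := clc t _ HP; rewrite !nbhs_simpl /=.
  apply: (@filterS _ (nbhs t)) => s /= Hs; exact: Hs (clP s).
- by rewrite /= clE // lexx ler01.
- by rewrite /= clE // lexx ler01.
- by move=> s t s01 t01 /=; rewrite !clE //; apply: fi; rewrite in_itv.
- by move=> t t01 /=; exists (cl t) => //; exact: clP.
Qed.

(** After a shift by [B], finitely many intervals of length [d] cover the range; [q] returns the
    number of the interval. *)
Lemma exists_rounding (R : realType) (B d : R) : 0 < d ->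
  exists n (q : R -> 'I_n), forall u, `|u| <= B ->
    (q u)%:R * d <= u + B < (q u).+1%:R * d.
Proof.
move=> d0; pose N := Num.truncn (2 * B / d).
exists N.+1, (fun u => inord (Num.truncn ((u + B) / d))) => u uB.
have uB' : 0 <= u + B <= 2 * B by move: uB; rewrite ler_norml; lra.
have le : (Num.truncn ((u + B) / d) <= N)%N.
  by apply: le_truncn; rewrite ler_pM2r ?invr_gt0 //; lra.
rewrite inordK // -ler_pdivlMr // -ltr_pdivrMr //; apply: truncn_itv.
by apply: divr_ge0; lra.
Qed.

(** * Parametrized arcs of a plane drawing *)

Section Drawing.

Variables (R : realType) (T : finType) (G : sgraph T).

(* Each edge is drawn once, from its smaller end. *)
Definition oriented : rel T := [rel x y | G x y && (enum_rank x < enum_rank y)%N].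

Lemma orientedE x y : G x y = oriented x y || oriented y x.
Proof.
rewrite /oriented /= [G y x]adj_sym -andb_orr; case: (ltngtP (enum_rank x)) => //=.
  by rewrite andbT.
  by rewrite andbT.
by move/val_inj/enum_rank_inj => ->; rewrite adj_irr.
Qed.

Lemma oriented_set2 x y u v : oriented x y -> oriented u v ->
  [set x; y]%SET = [set u; v]%SET -> x = u /\ y = v.
Proof.
move=> /andP[_ xy] /andP[_ uv] E.
have : x \in [set u; v]%SET by rewrite -E !inE eqxx.
have : y \in [set u; v]%SET by rewrite -E !inE eqxx orbT.
have : u \in [set x; y]%SET by rewrite E !inE eqxx.
have : v \in [set x; y]%SET by rewrite E !inE eqxx orbT.
rewrite !inE => /pred2P[?|?] /pred2P[?|?] /pred2P[?|?] /pred2P[?|?]; subst => //;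
  by move: xy uv; rewrite ?ltnn //; lia.
Qed.

(** By orientation, different arcs have different vertex sets, so the clause on crossings applies to
    them; on a single arc injectivity decides. *)
Lemma planar_arcs : planar R G ->
  exists (pos : T -> R * R) (f : T -> T -> R -> R * R),
  [/\ injective pos,
      forall x y, oriented x y -> [/\ continuous (f x y), f x y 0 = pos x & f x y 1 = pos y],
      forall x y z (t : R), oriented x y -> 0 <= t <= 1 -> f x y t = pos z ->
        z = x /\ t = 0 \/ z = y /\ t = 1 &
      forall x y u v (s t : R), oriented x y -> oriented u v -> 0 <= s <= 1 -> 0 <= t <= 1 ->
        f x y s = f u v t -> [/\ x = u, y = v & s = t] \/ exists z, f x y s = pos z].
Proof.
case=> pos [edge [pos_inj arcs pos_arc meet]].
have fE (xy : T * T) : exists f : R -> R * R, oriented xy.1 xy.2 ->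
    [/\ continuous f, f 0 = pos xy.1, f 1 = pos xy.2,
      forall s t, 0 <= s <= 1 -> 0 <= t <= 1 -> f s = f t -> s = t &
      forall t, 0 <= t <= 1 -> edge [set xy.1; xy.2]%SET (f t)].
  case: (boolP (oriented xy.1 xy.2)) => [/andP[/arcs/jordan_arc_param[f Hf] _]|no].
    by exists f.
  by exists (cst 0).
have [f fP] := boolp.choice fE; exists pos, (fun x y => f (x, y)); split=> //.
- by move=> x y /(fP (x, y))[].
- move=> x y z t xy t01 ft; have [_ f0 f1 fi fA] := fP (x, y) xy.
  have /= [Gxy _] := andP xy.
  have := pos_arc x y z Gxy; rewrite -ft => /(_ (fA _ t01)); rewrite !inE => /orP[/eqP zE|/eqP zE].
    by left; split=> //; apply: fi => //; rewrite ?lexx ?ler01 // ft zE f0.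
  by right; split=> //; apply: fi => //; rewrite ?lexx ?ler01 // ft zE f1.
- move=> x y u v s t xy uv s01 t01 st.
  have /= [Gxy _] := andP xy; have /= [Guv _] := andP uv.
  have [_ _ _ fi fA] := fP (x, y) xy; have [_ _ _ _ gA] := fP (u, v) uv.
  have [E|E] := pselect ([set x; y]%SET = [set u; v]%SET).
    by left; have [xu yv] := oriented_set2 xy uv E; subst; split=> //; exact: fi.
  right; have [|z _ ->] := meet x y u v Gxy Guv E (f (x, y) s) (fA s s01).
    by rewrite st; exact: gA.
  by exists z.
Qed.

End Drawing.

(** * Discretizing the drawing *)

Section Labelling.

Variables (R : realType) (T : finType) (G : sgraph T).
Variables (pos : T -> R * R) (f : T -> T -> R -> R * R).
Let H := oriented G.
Hypothesis pos_inj : injective pos.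
Hypothesis f_arc : forall x y, H x y -> [/\ continuous (f x y), f x y 0 = pos x & f x y 1 = pos y].
Hypothesis f_pos : forall x y z (t : R), H x y -> 0 <= t <= 1 -> f x y t = pos z ->
  z = x /\ t = 0 \/ z = y /\ t = 1.
Hypothesis f_meet : forall x y u v (s t : R), H x y -> H u v -> 0 <= s <= 1 -> 0 <= t <= 1 ->
  f x y s = f u v t -> [/\ x = u, y = v & s = t] \/ exists z, f x y s = pos z.

(** Closed thirds keep the pieces compact; a star then touches the middle thirds of its own arcs,
    hence the two alternatives in [star_middle]. *)
Definition star v : set (R * R) := [set a | [\/ a = pos v,
  exists y t, [/\ H v y, 0 <= t <= 1 / 3 & a = f v y t] |
  exists x t, [/\ H x v, 2 / 3 <= t <= 1 & a = f x v t]]].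

Lemma star_pos v z : star v (pos z) -> z = v.
Proof.
case=> [/pos_inj//|[y [t [vy t01 /esym E]]]|[x [t [xv t01 /esym E]]]].
  have t01' : 0 <= t <= 1 by lra.
  by have [[//]|[_ t1]] := f_pos vy t01' E; exfalso; lra.
have t01' : 0 <= t <= 1 by lra.
by have [[_ t0]|[//]] := f_pos xv t01' E; exfalso; lra.
Qed.

(** A vertex lies in no star but its own. Elsewhere distinct arcs are disjoint, and the first third
    of an arc avoids its last third. *)
Lemma star_inj u v a : star u a -> star v a -> u = v.
Proof.
have [[z ->]|npos] := pselect (exists z, a = pos z).
  by move=> /star_pos <- /star_pos <-.
have meet x y x' y' s t : H x y -> H x' y' -> 0 <= s <= 1 -> 0 <= t <= 1 ->
    a = f x y s -> a = f x' y' t -> [/\ x = x', y = y' & s = t].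
  move=> xy x'y' s01 t01 as_ at_.
  have [|//|[z az]] := f_meet xy x'y' s01 t01; first by rewrite -as_ -at_.
  by case: npos; exists z; rewrite as_.
have sub1 (t : R) : 0 <= t <= 1 / 3 -> 0 <= t <= 1 by lra.
have sub2 (t : R) : 2 / 3 <= t <= 1 -> 0 <= t <= 1 by lra.
case=> [au|[y [t [uy t01 at_]]]|[y [t [yu t01 at_]]]]; first by case: npos; exists u.
- case=> [av|[z [s [vz s01 as_]]]|[z [s [zv s01 as_]]]]; first by case: npos; exists v.
    by have [] := meet _ _ _ _ _ _ uy vz (sub1 _ t01) (sub1 _ s01) at_ as_.
  by have [_ _ ts] := meet _ _ _ _ _ _ uy zv (sub1 _ t01) (sub2 _ s01) at_ as_; exfalso; lra.
- case=> [av|[z [s [vz s01 as_]]]|[z [s [zv s01 as_]]]]; first by case: npos; exists v.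
    by have [_ _ ts] := meet _ _ _ _ _ _ yu vz (sub2 _ t01) (sub1 _ s01) at_ as_; exfalso; lra.
  by have [] := meet _ _ _ _ _ _ yu zv (sub2 _ t01) (sub2 _ s01) at_ as_.
Qed.

Lemma middle_npos x y t z : H x y -> 1 / 3 <= t <= 2 / 3 -> f x y t <> pos z.
Proof.
move=> xy t12 E; have t01 : 0 <= t <= 1 by lra.
by have [[_ t0]|[_ t1]] := f_pos xy t01 E; lra.
Qed.

Lemma star_middle u x y t : H x y -> 1 / 3 <= t <= 2 / 3 -> star u (f x y t) -> u = x \/ u = y.
Proof.
move=> xy t12; have t01 : 0 <= t <= 1 by lra.
case=> [/(middle_npos xy t12)//|[z [s [uz s01 E]]]|[z [s [zu s01 E]]]].
- have {}s01 : 0 <= s <= 1 by lra.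
  by have [[-> _ _]|[w /(middle_npos xy t12)//]] := f_meet xy uz t01 s01 E; left.
- have {}s01 : 0 <= s <= 1 by lra.
  by have [[_ -> _]|[w /(middle_npos xy t12)//]] := f_meet xy zu t01 s01 E; right.
Qed.

Definition third (i : 'I_3) : set R := `[i%:R / 3, i.+1%:R / 3].

Lemma thirdP i t : third i t <-> i%:R / 3 <= t <= i.+1%:R / 3.
Proof. by rewrite /third /= in_itv. Qed.

Definition piece : finType := (T + T * T * 'I_3)%type.

Definition piece_set (i : piece) : set (R * R) :=
  match i with
  | inl v => [set pos v]
  | inr (x, y, k) => if H x y then f x y @` third k else set0
  end.

Lemma compact_piece i : compact (piece_set i).
Proof.
case: i => [v|[[x y] k]] /=; first exact: compact_set1.
case: ifP => [xy|_]; last exact: compact0.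
apply: continuous_compact; last exact: segment_compact.
by apply: continuous_subspaceT; have [] := f_arc xy.
Qed.

(** Disjoint compact pieces are a positive distance apart, and there are only finitely many pairs of
    pieces. *)
Lemma exists_scale : exists2 e : R, 0 < e & forall i j a b,
  piece_set i a -> piece_set j b -> ball a e b -> exists c, piece_set i c /\ piece_set j c.
Proof.
have gap : \forall e \near (0 : R)^'+, forall ij : piece * piece, forall a b,
    piece_set ij.1 a -> piece_set ij.2 b -> ball a e b ->
    exists c, piece_set ij.1 c /\ piece_set ij.2 c.
  apply: filter_forall => -[i j] /=.
  have [E|/eqP/set0P[c [ic jc]]] := pselect (piece_set i `&` piece_set j = set0).
    have := compact_gap (@compact_piece i) (@compact_piece j) E.
    apply: filterS => e He a b ia jb ab.
    by case: (He a b ia jb).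
  by apply: filterE => e a b _ _ _; exists c.
have [e [He e0]] := filter_ex (filterI gap (nbhs_right_gt 0)).
by exists e => // i j a b; apply: He (i, j) a b.
Qed.

Lemma exists_mesh d : 0 < d -> exists2 m : nat, (0 < m)%N & forall x y s t, H x y ->
  0 <= s <= 1 -> `|s - t| <= (3 * m)%:R^-1 -> ball (f x y s) d (f x y t).
Proof.
move=> d0; have unif : \forall e \near (0 : R)^'+, forall xy : T * T, H xy.1 xy.2 ->
    forall s t, 0 <= s <= 1 -> `|s - t| < e -> ball (f xy.1 xy.2 s) d (f xy.1 xy.2 t).
  apply: filter_forall => -[x y] /=; have [xy|nxy] := boolP (H x y).
    have [fc _ _] := f_arc xy.
    by have := uniform_continuity_segment 0 1 fc d0; apply: filterS => e He _.
  exact: filterE.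
have [e [He e0]] := filter_ex (filterI unif (nbhs_right_gt 0)).
(* This [m] exceeds [1 / e], so the mesh [1 / (3 * m)] is below [e]. *)
exists (Num.truncn e^-1).+1 => // x y s t xy s01 st; apply: (He (x, y)) => //.
apply: le_lt_trans st _; rewrite invf_plt ?posrE ?ltr0n ?muln_gt0 //.
apply: lt_le_trans (truncnS_gt _) _; by rewrite ler_nat leq_pmull.
Qed.

Lemma exists_bound : exists B : R, forall i a, piece_set i a -> `|a.1| <= B /\ `|a.2| <= B.
Proof.
have bnd : \forall M \near +oo, forall i a, piece_set i a -> `|a| <= M.
  apply: filter_forall => i; exact: (compact_bounded (@compact_piece i)).
have [B HB] := filter_ex bnd; exists B => i a /HB.
by rewrite prod_normE ge_max => /andP.
Qed.

(** Arcs are sampled finely and rounded to cells of side [d]. Pieces that round to a common cell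
    must intersect, so disjointness in the plane yields the disjointness hypotheses of
    [walks_labelling]. *)
Lemma drawing_labelling : exists n (lab : cell n -> option T),
  [/\ forall x, exists p, lab p = Some x,
      forall p q x, lab p = Some x -> lab q = Some x ->
        connect [rel p q | [&& @cell_adj n p q, lab p == Some x & lab q == Some x]] p q &
      forall x y, G x y -> exists p q, [/\ lab p = Some x, lab q = Some y & cell_adj p q]].
Proof.
(* A third of [e], because points near the same cell are linked by three hops shorter than [d]. *)
have [e e0 scale] := exists_scale; pose d := e / 3; have d0 : 0 < d by rewrite /d; lra.
have [m m0 mesh] := exists_mesh d0.
have [B bound] := exists_bound.
have [n [q qP]] := exists_rounding B d0.
have q_le u v : `|u| <= B -> `|v| <= B -> `|u - v| < d -> (q u <= (q v).+1)%N.
  move=> /qP uP /qP vP; rewrite ltr_norml => uv.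
  rewrite -ltnS -(ltr_nat R) -(ltr_pM2r d0) [X in _ < X](_ : _ = (q v).+1%:R * d + d).
    lra.
  by rewrite -[(q v).+2]addn1 natrD mulrDl mul1r.
have q_eq u v : `|u| <= B -> `|v| <= B -> q u = q v -> `|u - v| < d.
  move=> /qP uP /qP vP uv; move: uP; rewrite uv -!(addn1 (q v)) natrD mulrDl mul1r => uP.
  by move: vP; rewrite -(addn1 (q v)) natrD mulrDl mul1r ltr_norml; lra.
(* The rounded point [u] may lie off the arc, since the walk below mixes the coordinates of
   consecutive samples. *)
pose near_cell a c := exists u, [/\ c = (q u.1, q u.2), `|u.1| <= B, `|u.2| <= B & ball a d u].
have near_eq i j a b c : piece_set i a -> piece_set j b -> near_cell a c -> near_cell b c ->
    exists z, piece_set i z /\ piece_set j z.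
  move=> ia jb [u [-> u1 u2 [au1 au2]]] [v [[qu1 qu2] v1 v2 [bv1 bv2]]].
  have uv1 := q_eq _ _ u1 v1 qu1; have uv2 := q_eq _ _ u2 v2 qu2.
  apply: (scale i j a b) => //.
  have dE : e = d + d + d by rewrite /d; lra.
  split; rewrite /= dE.
  - by apply: ball_triangle (ball_sym bv1); apply: ball_triangle au1 _; rewrite -ball_normE.
  - by apply: ball_triangle (ball_sym bv2); apply: ball_triangle au2 _; rewrite -ball_normE.
pose on1 v c := exists i a, [/\ piece_set i a, near_cell a c & piece_set i `<=` star v].
pose on2 x y c := H x y /\ exists a, piece_set (inr (x, y, 1%R)) a /\ near_cell a c.
pose t k : R := k%:R / (3 * m)%:R.
have m3 : 0 < (3 * m)%:R :> R by rewrite ltr0n muln_gt0.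
have tP (a b c : nat) : (a * m <= b <= c * m)%N -> a%:R / 3 <= t b <= c%:R / 3.
  rewrite -!(ler_nat R) !natrM /t => /andP[ab bc].
  have m0' : 0 < m%:R :> R by rewrite ltr0n.
  have E (z : nat) : z%:R / 3 = z%:R * m%:R / (3 * m)%:R :> R.
    by rewrite natrM -mulf_div divff ?mulr1 // gt_eqF.
  by rewrite !E !ler_pM2r ?invr_gt0 ?ab.
have t01 k : (k <= 3 * m)%N -> 0 <= t k <= 1.
  by move=> k3; have := tP 0%N k 3%N; rewrite k3 mul0n leq0n => /(_ isT); lra.
pose pt v : cell n := (q (pos v).1, q (pos v).2).
(* Two consecutive cells of this walk differ in one coordinate only. *)
pose w x y j : cell n := (q (f x y (t (uphalf j))).1, q (f x y (t (half j))).2).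
have f_bound x y k : H x y -> (k <= 3 * m)%N ->
    `|(f x y (t k)).1| <= B /\ `|(f x y (t k)).2| <= B.
  move=> xy k3; have [i ik] : exists i : 'I_3, third i (t k).
    have [k1|k1] := leqP k m.
      by exists 0; apply/thirdP; apply: tP; rewrite mul0n mul1n.
    have [k2|k2] := leqP k (2 * m).
      by exists 1; apply/thirdP; apply: tP; rewrite mul1n ltnW.
    by exists 2; apply/thirdP; apply: tP; rewrite k3 ltnW.
  by apply: (bound (inr (x, y, i))); rewrite /= xy; exists (t k).
have t_step k j : (j <= k <= j.+1)%N -> `|t j - t k| <= (3 * m)%:R^-1.
  move=> /andP[jk kj]; rewrite distrC /t -mulrBl -natrB // ger0_norm ?divr_ge0 ?ler0n //.
  by rewrite ler_piMl ?invr_ge0 ?ler0n // lern1 leq_subLR addn1.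
have f_succ x y k : H x y -> (k < 3 * m)%N -> let u := f x y (t k) in let v := f x y (t k.+1) in
    [/\ (q u.1 <= (q v.1).+1)%N, (q v.1 <= (q u.1).+1)%N,
        (q u.2 <= (q v.2).+1)%N & (q v.2 <= (q u.2).+1)%N].
  move=> xy k3; have [u1 u2] := f_bound x y k xy (ltnW k3); have [v1 v2] := f_bound x y k.+1 xy k3.
  have [|uv1 uv2] := mesh x y (t k) (t k.+1) xy (t01 k (ltnW k3)) _.
    by apply: t_step; rewrite leqnn leqnSn.
  move: uv1 uv2; rewrite -!ball_normE /= => uv1 uv2.
  by split; apply: q_le => //; rewrite distrC.
have w_near x y j : H x y -> (j <= 3 * (2 * m))%N -> near_cell (f x y (t (half j))) (w x y j).
  move=> xy jm; have h1 : (half j <= 3 * m)%N by lia.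
  have h2 : (uphalf j <= 3 * m)%N by lia.
  have [b1 b2] := f_bound x y _ xy h1; have [b3 b4] := f_bound x y _ xy h2.
  exists ((f x y (t (uphalf j))).1, (f x y (t (half j))).2); split=> //.
  have [] : ball (f x y (t (half j))) d (f x y (t (uphalf j))).
    by apply: mesh xy (t01 _ h1) _; apply: t_step; lia.
  by split=> //=; exact: ballxx.
have w_piece x y j (i : 'I_3) : H x y -> (i * (2 * m) <= j <= i.+1 * (2 * m))%N ->
    piece_set (inr (x, y, i)) (f x y (t (half j))).
  move=> xy ij; rewrite /= xy; exists (t (half j)) => //; apply/thirdP/tP; lia.
(* Each sampling step costs two walk steps, one per coordinate, so a third of a walk has length
   [2 * m]. *)
have [||||||||||lab [lab1 lab2 lab3]] := @walks_labelling n T H (2 * m) pt w on1 on2.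
- move=> x y xy; have [_ f0 f1] := f_arc xy; rewrite /w /pt /= /t mul0r f0; split=> //.
  have -> : uphalf (3 * (2 * m)) = (3 * m)%N by lia.
  have -> : half (3 * (2 * m)) = (3 * m)%N by lia.
  by rewrite divff ?gt_eqF // f1.
- move=> x y k xy km; apply: cell_adj_or; rewrite /w /=.
  have k3 : (k./2 < 3 * m)%N by lia.
  have [kodd|keven] := boolP (odd k).
    have -> : uphalf k = k./2.+1 by rewrite uphalf_half kodd.
    by left; have [_ _ ? ?] := f_succ x y _ xy k3; split.
  have -> : uphalf k = k./2 by rewrite uphalf_half (negbTE keven).
  by right; have [? ? _ _] := f_succ x y _ xy k3; split.
- move=> x; exists (inl x), (pos x); split=> //.
    have [b1 b2] := bound (inl x) (pos x) erefl.
    by exists (pos x); split=> //; exact: ballxx.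
  by move=> a ->; constructor 1.
- move=> x y k xy km; exists (inr (x, y, 0)), (f x y (t (half k))); split.
  + by apply: w_piece => //; change (0 * (2 * m) <= k <= 1 * (2 * m))%N; lia.
  + by apply: w_near => //; lia.
  + move=> a /=; rewrite xy => -[s /thirdP s1 <-]; constructor 2; exists y, s.
    by split=> //; have {}s1 : 0%:R / 3 <= s <= 1%:R / 3 := s1; lra.
- move=> x y k xy km; split=> //; exists (f x y (t (half k))); split.
  + by apply: w_piece => //; change (1 * (2 * m) <= k <= 2 * (2 * m))%N; lia.
  + by apply: w_near => //; lia.
- move=> x y k xy km; exists (inr (x, y, 2)), (f x y (t (half k))); split.
  + by apply: w_piece => //; change (2 * (2 * m) <= k <= 3 * (2 * m))%N.
  + by apply: w_near => //; lia.
  + move=> a /=; rewrite xy => -[s /thirdP s1 <-]; constructor 3; exists x, s.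
    by split=> //; have {}s1 : 2%:R / 3 <= s <= 3%:R / 3 := s1; lra.
- move=> u v c [i [a [ia ac iu]]] [j [b [jb bc jv]]].
  by have [z [/iu zu /jv zv]] := near_eq _ _ _ _ _ ia jb ac bc; exact: star_inj zu zv.
- move=> u x y c [i [a [ia ac iu]]] [xy [b [jb bc]]].
  have [z [/iu zu]] := near_eq _ _ _ _ _ ia jb ac bc; rewrite /= xy => -[s /thirdP s12 sz].
  have {}s12 : 1%:R / 3 <= s <= 2%:R / 3 := s12.
  by apply: (@star_middle u x y s); rewrite // sz.
- move=> x y u v c _ _ [xy [a [ia ac]]] [uv [b [jb bc]]].
  have [z []] := near_eq _ _ _ _ _ ia jb ac bc; rewrite /= xy uv => -[s /thirdP s12 <-].
  case=> r /thirdP r12 /esym sr.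
  have {}s12 : 1%:R / 3 <= s <= 2%:R / 3 := s12; have {}r12 : 1%:R / 3 <= r <= 2%:R / 3 := r12.
  have s01 : 0 <= s <= 1 by lra.
  have r01 : 0 <= r <= 1 by lra.
  have [[]//|[z' E]] := f_meet xy uv s01 r01 sr.
  by case: (middle_npos xy _ E).
- by move=> x; rewrite /H /oriented /= adj_irr.
by exists n, lab; split=> // x y; rewrite orientedE; exact: lab3.
Qed.

End Labelling.

Local Close Scope ring_scope.
Local Close Scope classical_set_scope.

Theorem theorem5 (R : realType) (T : finType) (G : sgraph T)
    (Gconn : connected_graph G) (Gplanar : planar R G) :
  exists G1 G2 : sgraph T,
    [/\ CCW G1 <= 7, chordal G2 &
        forall x y : T, G x y = G1 x y && G2 x y].
Proof.
have [pos [f [pos_inj f_arc f_pos f_meet]]] := planar_arcs Gplanar.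
have [n [lab [lab_surj lab_conn lab_adj]]] := drawing_labelling pos_inj f_arc f_pos f_meet.
exact: labelled_grid_intersection lab_surj lab_conn lab_adj.
Qed.
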